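(* Every $w_b$-$q_f$-space $X$ is $\mu^{\#}_{cc}$-complete; that is, every relatively countably compact subset of $C_p(X)$ has compact closure in $C_p(X)$.
   Context: All spaces are Tychonoff. $C_p(X)$ is the space of continuous real-valued functions on $X$ with the topology of pointwise convergence. A subset $Z$ of a space $T$ is relatively countably compact in $T$ if every sequence in $Z$ has an accumulation point in $T$. A subset $P$ of $X$ is bounded in $X$ if every continuous function $X\to\mathbb R$ is bounded on $P$; it is $\sigma$-bounded if it is a countable union of sets bounded in $X$. $\mathcal P_b(X)$ is the family of all $M\subset X$ such that some $\sigma$-bounded subset of $X$ is contained and dense in $M$. Subsets $A,B$ of $X$ are functionally separated if there is a continuous $g:X\to[0,1]$ with $g(A)\subset\{0\}$ and $g(B)\subset\{1\}$. The game $\Gamma(AV(X,x,A,\lambda),I_f)$: let $A\subset X$, $x\in\overline A\setminus A$, and let $\lambda$ be a cover of $X$. Two players $\alpha$ and $\beta$ play for countably many steps $n=0,1,2,\dots$. At step $n$, player $\beta$ chooses a neighborhood $V_n$ of $x$, then player $\alpha$ chooses $S_n\subset A$ such that $S_n\subset L$ for some $L\in\lambda$. Player $\alpha$ wins if there exists $S\subset\bigcap_n V_n$ such that $S\subset L$ for some $L\in\lambda$ and the sets $S$ and $\bigcup_n S_n$ are not functionally separated. Strategies may depend on all previous moves; the game is $\beta$-unfavorable if $\beta$ has no winning strategy. $X$ is a $w$-$q_f$-space with respect to $\lambda$ if for every discontinuous function $f:X\to\mathbb R$ there are a non-closed $A\subset X$ and a point $x\in\overline A\setminus A$ such that $f(x)\notin\overline{f(A)}$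 and the game $\Gamma(AV(X,x,A,\lambda),I_f)$ is $\beta$-unfavorable. $X$ is a $w_b$-$q_f$-space if it is a $w$-$q_f$-space with respect to $\mathcal P_b(X)$. *)

(* Defs.v *)
From HB Require Import structures.
From mathcomp Require Import all_boot all_order all_algebra.
From mathcomp Require Import all_classical all_reals all_analysis.

Set Implicit Arguments.
Unset Strict Implicit.
Unset Printing Implicit Defensive.

Import Order.TTheory GRing.Theory Num.Theory.
Import numFieldNormedType.Exports.

Local Open Scope classical_set_scope.
Local Open Scope ring_scope.

(* C_p(X): the continuous functions X -> R, as a subspace of the product R^X.
   An alias is used so that the pointwise topology stays attached to this type,
   whichever of the topologies on function spaces is imported. *)
Definition Cp (R : realType) (X : topologicalType) : Type := continuousType X R.

HB.instance Definition _ (R : realType) (X : topologicalType) :=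
  Topological.copy (Cp R X)
    (initial_topology (id : continuousType X R -> {ptws X -> R})).

(* The accumulation points of a sequence are the cluster points of its
   Frechet filter, not the limit points of its range. *)
Definition relatively_countably_compact (T : topologicalType) (Z : set T) :=
  forall u : nat -> T, (forall n, Z (u n)) ->
    exists p : T, cluster (u @ \oo) p.

Definition mu_sharp_cc_complete (R : realType) (X : topologicalType) :=
  forall Z : set (Cp R X),
    relatively_countably_compact Z -> compact (closure Z).

Definition bounded_in (R : realType) (X : topologicalType) (P : set X) :=
  forall f : X -> R, continuous f -> [bounded f z | z in P].

Definition sigma_bounded_in (R : realType) (X : topologicalType) (P : set X) :=
  exists2 B : nat -> set X,
    (forall n, bounded_in R (B n)) & P = \bigcup_n B n.

Definition Pb (R : realType) (X : topologicalType) : set (set X) :=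
  [set M | exists D : set X,
    [/\ sigma_bounded_in R D, D `<=` M & M `<=` closure D]].

Definition functionally_separated (R : realType) (X : topologicalType)
    (A B : set X) :=
  exists g : X -> R, [/\ continuous g, range g `<=` `[0, 1],
    g @` A `<=` [set 0] & g @` B `<=` [set 1]].

(* The game Gamma(AV(X, x, A, lambda), I_f). A play is a pair of sequences
   V (moves of beta) and S (moves of alpha); at step n, beta moves first. *)
Section Game.
Variables (R : realType) (X : topologicalType).
Implicit Types (x : X) (A : set X) (lambda : set (set X)) (V S : nat -> set X).

Definition alpha_legal A lambda S :=
  forall n, S n `<=` A /\ exists2 L, lambda L & S n `<=` L.

Definition alpha_wins lambda V S :=
  exists T : set X, [/\ T `<=` \bigcap_n V n,
    exists2 L, lambda L & T `<=` L &
    ~ functionally_separated R T (\bigcup_n S n)].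

(* A strategy of beta maps the moves (V_0, S_0), ..., (V_(n-1), S_(n-1))
   of the first n steps to a neighborhood V_n of x. *)
Definition beta_strategy x (s : seq (set X * set X) -> set X) :=
  forall h, nbhs x (s h).

Definition beta_follows (s : seq (set X * set X) -> set X) V S :=
  forall n, V n = s (mkseq (fun k => (V k, S k)) n).

Definition beta_winning x A lambda (s : seq (set X * set X) -> set X) :=
  beta_strategy x s /\
  forall V S, beta_follows s V S -> alpha_legal A lambda S ->
    ~ alpha_wins lambda V S.

Definition beta_unfavorable x A lambda :=
  ~ exists s, beta_winning x A lambda s.

End Game.

Definition w_qf_space (R : realType) (X : topologicalType)
    (lambda : set (set X)) :=
  forall f : X -> R, ~ continuous f ->
    exists (A : set X) (x : X),
      [/\ ~ closed A, (closure A `\` A) x, ~ closure (f @` A) (f x) &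
          beta_unfavorable R x A lambda].

Definition wb_qf_space (R : realType) (X : topologicalType) :=
  w_qf_space R (@Pb R X).

(* In the definition of the game lambda is a cover of X; so is Pb. *)
Lemma Pb_cover (R : realType) (X : topologicalType) :
  \bigcup_(M in @Pb R X) M = setT.
Proof.
apply/seteqP; split => // x _; exists [set x] => //.
exists [set x]; split => //; last exact: subset_closure.
exists (fun=> [set x]); last by rewrite bigcup_const //; exists 0%N.
move=> _ f _; exists `|f x|; split; first exact: num_real.
by move=> M ltM y /= ->; exact: ltW.
Qed.

(* Main.v *)
Require Import Defs.
From HB Require Import structures.
From mathcomp Require Import all_boot all_order all_algebra.
From mathcomp Require Import all_classical all_reals all_analysis.
From mathcomp Require Import lra.

Set Implicit Arguments.
Unset Strict Implicit.
Unset Printing Implicit Defensive.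

Import Order.TTheory GRing.Theory Num.Theory.
Import numFieldNormedType.Exports.

Local Open Scope classical_set_scope.
Local Open Scope ring_scope.

(* Let [f] be a pointwise limit of a relatively countably compact set [Z] of
   continuous functions, and suppose that [f] is discontinuous, with [A] and [x]
   as in the definition of a [w_b]-[q_f]-space. Player beta keeps choosing
   functions [u_n] in [Z] which approximate [f] at [x] and on finitely many
   points, and plays the set where [u_0, ..., u_(n-1)] are within [1/(n+1)] of
   their values at [x]. The points are taken from countable nets, for the
   pseudometrics given by [f] and the [u_i] found so far, of the bounded sets
   [B] whose union is dense around alpha's moves. A cluster point [h] of the
   [u_n] in [C_p(X)] equals [f] on the nets, and a point [z] of [B] is
   approached by points [w] of the net of [B] with [f w] close to [f z] and
   [u_i w] close to [u_i z]; as [B] is bounded, [h w] is then close to [h z]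
   and so [h = f] on [B]. Adding one point to [B], the same argument shows that
   [f] agrees with a continuous function on the union of the [B]'s with that
   point, hence [h = f] on alpha's moves. There [|f - f x|] is bounded below,
   whereas [h = f x] on the intersection of beta's moves: [h] separates the two
   sets, and beta wins. *)

(** * Pointwise topology and cluster points of sequences *)

Lemma Cp_eval_continuous (R : realType) (X : topologicalType) (y : X) :
  continuous (fun g : Cp R X => g y).
Proof.
move=> g.
apply: (@continuous_comp _ _ _ (id : Cp R X -> {ptws X -> R})
  (fun k : {ptws X -> R} => k y)); first exact: initial_continuous.
have /pointwise_cvgP : {ptws, nbhs (g : {ptws X -> R}) --> (g : X -> R)} by [].
exact.
Qed.

Lemma Cp_cvgP (R : realType) (X : topologicalType) (F : set_system (Cp R X))
    (q : Cp R X) : Filter F ->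
  (forall y, g y @[g --> F] --> q y) -> F --> q.
Proof.
move=> FF Fq U; rewrite nbhsE => -[W [[W' oW' <-] Wq] WU].
have cvF : {ptws, ((id : Cp R X -> {ptws X -> R}) @ F) --> (q : X -> R)}.
  by apply/pointwise_cvgP => t; exact: Fq.
apply: filterS WU _.
by apply: cvF; exact: open_nbhs_nbhs.
Qed.

Lemma eqr_dist_le (R : realType) (a b : R) :
  (forall e, 0 < e -> `|a - b| <= e) -> a = b.
Proof.
move=> ab; apply/eqP; rewrite -subr_eq0 -normr_le0.
by apply/ler_addgt0Pl => e e0; rewrite addr0 ab.
Qed.

Lemma near_seq (T : eqType) (Y : Type) (F : set_system Y) (l : seq T)
    (P : T -> Y -> Prop) : Filter F ->
  (forall t, t \in l -> \forall y \near F, P t y) ->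
  \forall y \near F, forall t, t \in l -> P t y.
Proof.
move=> FF; elim: l => [|t l IH] Pl; first by apply: nearW.
have Pt := Pl t (mem_head t l).
have {}IH : \forall y \near F, forall t, t \in l -> P t y.
  by apply: IH => s sl; apply: Pl; rewrite inE sl orbT.
near=> y => s; rewrite inE => /predU1P[->|]; first by near: y.
by move: s; near: y.
Unshelve. all: by end_near. Qed.

(** Basic neighborhoods in [C_p(X)] test finitely many points, so arbitrarily late terms are close
    to [h] on all of [l] at once. *)
Lemma Cp_cluster (R : realType) (X : topologicalType) (u : nat -> Cp R X)
    (h : Cp R X) (l : seq X) (e : R) (N : nat) :
  cluster (u @ \oo) h -> 0 < e ->
  exists2 m, (N <= m)%N & forall y, y \in l -> `|u m y - h y| < e.
Proof.
move=> hcl e0.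
have Uh : nbhs h [set g : Cp R X | forall y, y \in l -> `|g y - h y| < e].
  apply: (near_seq (F := nbhs h) (P := fun y g => `|g y - h y| < e)) => y _.
  have /cvgrPdist_lt/(_ e e0) := @Cp_eval_continuous R X y h.
  by apply: filterS => g; rewrite distrC.
have uN : (u @ \oo) (u @` [set m | (N <= m)%N]).
  by exists N => // m /= Nm; exists m.
by have [_ [[m Nm <-] Um]] := hcl _ _ uN Uh; exists m.
Qed.

Lemma cluster_eq_lim (R : realType) (X : topologicalType) (u : nat -> Cp R X)
    (h : Cp R X) (y : X) (a : R) : cluster (u @ \oo) h ->
  (forall e : R, 0 < e -> exists N, forall m, (N <= m)%N -> `|u m y - a| < e) ->
  h y = a.
Proof.
move=> hcl ua; apply: eqr_dist_le => e e0.
have e20 : 0 < e / 2 by rewrite divr_gt0.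
have [N uN] := ua _ e20.
have [m /uN um] := Cp_cluster [:: y] N hcl e20.
move=> /(_ y (mem_head _ _)) => hm.
rewrite (le_trans (ler_distD (u m y) _ _))// [e]splitr distrC.
by rewrite lerD// ltW.
Qed.

Lemma cluster_fiber (R : realType) (X : topologicalType) (u : nat -> Cp R X)
    (h : Cp R X) (y z : X) : cluster (u @ \oo) h ->
  (forall n, u n y = u n z) -> h y = h z.
Proof.
move=> hcl uyz; apply: eqr_dist_le => e e0.
have [m _ um] :=
  Cp_cluster [:: y; z] 0 hcl (divr_gt0 e0 (ltr0n R 2)).
have := um y; have := um z; rewrite !inE !eqxx orbT => /(_ isT) hz /(_ isT).
rewrite uyz distrC => hy.
by rewrite (le_trans (ler_distD (u m z) _ _))// [e]splitr lerD// ltW.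
Qed.

(** * Bounded sets, countable nets and runs of approximations *)

(* [D y] measures the distance of [y] to the fiber of [z] under all the [u i];
   [G] is positive by the last hypothesis, and if the conclusion failed for
   every [N] then [1 / G] would be unbounded on [B]. *)
Lemma fiber_uniform_on_bounded (R : realType) (X : topologicalType)
    (u : nat -> X -> R) (h : X -> R) (B : set X) (z : X) (d : R) :
  (forall i, continuous (u i)) -> continuous h -> bounded_in R B -> 0 < d ->
  (forall y, (forall i, u i y = u i z) -> h y = h z) ->
  exists N, forall w, B w ->
    (forall i, (i < N)%N -> `|u i w - u i z| < N.+1%:R^-1) -> `|h w - h z| < d.
Proof.
move=> cu ch bB d0 hz.
(* Because of the cap [i.+1%:R^-1] only finitely many terms can reach a given [e], which makes the
   supremum [D] continuous. *)
pose t i y := Num.min (i.+1%:R^-1) `|u i y - u i z|.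
pose E y := range (t ^~ y).
have E0 y : E y !=set0 by exists (t 0%N y); exists 0%N.
have t1 i y : t i y <= 1.
  by rewrite ge_min invf_le1 ?ltr0n// ler1n.
have Eub y : has_ubound (E y) by exists 1 => _ [i _ <-].
pose D y := sup (E y).
have tD i y : t i y <= D y by apply: ub_le_sup => //; exists i.
have D_le y r : (forall i, t i y <= r) -> D y <= r.
  by move=> tr; apply: ge_sup => // _ [i _ <-].
have D0 y : 0 <= D y.
  by apply: le_trans (tD 0%N y); rewrite le_min normr_ge0 invr_ge0 ler0n.
have cD : continuous D.
  move=> y; apply/cvgrPdist_le => e e0.
  have [N _ /(_ N (leqnn N)) /= Ne] := near_infty_natSinv_lt (PosNum e0).
  have Ni i : (N <= i)%N -> i.+1%:R^-1 < e.
    move=> Ni; apply: le_lt_trans Ne.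
    by rewrite lef_pV2 ?posrE ?ltr0n// ler_nat.
  have : \forall y' \near y, forall i, i \in iota 0 N -> `|u i y - u i y'| < e.
    apply: (near_seq (F := nbhs y)
      (P := fun i y' => `|u i y - u i y'| < e)) => i _.
    by have /cvgrPdist_lt/(_ e e0) := cu i y.
  have key y1 y2 : (forall i, i \in iota 0 N -> `|u i y1 - u i y2| < e) ->
      D y1 <= D y2 + e.
    move=> ue; apply: D_le => i; case: (ltnP i N) => iN; last first.
      rewrite (le_trans (_ : _ <= i.+1%:R^-1)) ?ge_min ?lexx//.
      by rewrite (le_trans (ltW (Ni _ iN)))// lerDr.
    rewrite (le_trans (_ : _ <= t i y2 + e)) ?lerD2r//.
    have ui := ue i; rewrite mem_iota add0n /= iN in ui.
    rewrite /t addr_minl le_min !ge_min lerDl ltW//=; apply/orP; right.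
    rewrite (le_trans (ler_distD (u i y2) _ _))// addrC lerD2l.
    by rewrite ltW// ui.
  apply: filterS => y' uy'.
  have k1 := key _ _ uy'.
  have k2 : D y' <= D y + e by apply: key => i /uy'; rewrite distrC.
  by rewrite ler_norml; apply/andP; split; lra.
(* The second entry is [d] on the fiber of [z], where [D] vanishes, and at most [0] wherever the
   conclusion fails. *)
pose G y := Num.max (D y) (d - `|h y - h z|).
have G0 y : 0 < G y.
  rewrite /G lt_max; case: (ltP 0 (D y)) => //= Dy.
  rewrite hz ?subrr ?normr0 ?subr0// => i.
  have := tD i y; rewrite /t => /le_trans/(_ Dy).
  rewrite ge_min invr_le0 lern0 /= normr_le0 subr_eq0.
  by move=> /eqP.
have cG : continuous (fun y => (G y)^-1).
  move=> y; apply: continuousV; first by rewrite gt_eqF.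
  apply: continuous_max; first exact: cD.
  apply: cvgB; first exact: cvg_cst.
  by apply: cvg_norm; apply: cvgB; [exact: ch | exact: cvg_cst].
have [M [_ /(_ (M + 1))]] := bB _ cG.
rewrite ltrDl ltr01 => /(_ isT) GM.
(* With this [N], a violating [w] in [B] would give [G w <= N.+1%:R^-1], although
   [(G w)^-1 <= M + 1 < N.+1%:R]. *)
exists (Num.bound (M + 1)) => w Bw uw; rewrite ltNge; apply/negP => dh.
have : G w <= (Num.bound (M + 1)).+1%:R^-1.
  rewrite /G ge_max; apply/andP; split; last first.
    by rewrite (@le_trans _ _ 0) ?subr_le0// invr_ge0 ler0n.
  apply: D_le => i; rewrite /t ge_min.
  case: (ltnP i (Num.bound (M + 1))) => iN.
    by rewrite (ltW (uw _ iN)) orbT.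
  by rewrite lef_pV2 ?posrE ?ltr0n// ler_nat ltnS iN.
rewrite -[G w]invrK lef_pV2 ?posrE ?invr_gt0 ?ltr0n//.
apply/negP; rewrite -ltNge.
have /= := GM w Bw; rewrite gtr0_norm ?invr_gt0// => GwM.
have M0 : 0 <= M + 1 by rewrite (le_trans _ GwM)// invr_ge0 ltW.
by rewrite (le_lt_trans GwM)// (lt_trans (archi_boundP M0))// ltr_nat.
Qed.

(** The functions in [fs] map each [B k] into a finite power of the reals, which is separable: one
    point per nonempty trace of a rational box suffices. *)
Lemma countable_net (R : realType) (X : topologicalType) (x0 : X)
    (fs : seq (X -> R)) (B : nat -> set X) :
  exists c : nat -> X, forall k z (e : R), B k z -> 0 < e ->
    exists2 j, B k (c j) & forall g, g \in fs -> `|g (c j) - g z| < e.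
Proof.
(* A code [t] holds an index, the rational centers of a box and a precision; [x0] fills in for
   invalid codes and empty traces. *)
pose W (t : nat * seq rat * nat) := [set w | B t.1.1 w /\
  forall i, (i < size fs)%N ->
    `|nth (fun=> 0) fs i w - ratr (nth 0 t.1.2 i)| < t.2.+1%:R^-1].
exists (fun n => if unpickle n is Some t then xget x0 (W t) else x0).
move=> k z e Bz e0; have e20 : 0 < e / 2 by rewrite divr_gt0.
have [p _ /(_ p (leqnn p)) /= pe] := near_infty_natSinv_lt (PosNum e20).
have /choice[r rP] : forall v : R, exists q : rat, `|v - ratr q| < p.+1%:R^-1.
  move=> v; have p0 : 0 < p.+1%:R^-1 :> R by rewrite invr_gt0.
  have [|q] := @rat_in_itvoo R (v - p.+1%:R^-1) (v + p.+1%:R^-1).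
    by rewrite ltrBlDr -addrA ltrDl addr_gt0.
  rewrite in_itv /= => /andP[q1 q2]; exists q.
  move: (p.+1%:R^-1) q1 q2 => a q1 q2.
  by rewrite ltr_norml; apply/andP; split; lra.
pose t := (k, [seq r (g z) | g : X -> R <- fs], p).
have Wz : W t z.
  split => // i ifs; rewrite (nth_map (fun=> 0))//; exact: rP.
exists (pickle t); rewrite pickleK.
  by have [] := xgetPex x0 (ex_intro _ z Wz).
move=> g /(nthP (fun=> 0))[i ifs <-].
have [_ /(_ _ ifs) w1] := xgetPex x0 (ex_intro _ z Wz).
have [_ /(_ _ ifs) w2] := Wz.
rewrite (le_lt_trans (ler_distD (ratr (nth 0 t.1.2 i)) _ _))// [e]splitr.
by rewrite [X in _ + X]distrC ltrD// (lt_trans _ pe).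
Qed.

(* The [n]-th function of a run depends only on [beta 0, ..., beta n], so that
   a strategy can compute it from the past of a play. *)
Lemma tracking_functions (R : realType) (X : topologicalType) (x0 : X)
    (Z : set (Cp R X)) (f : X -> R) :
  (forall (l : seq X) (e : R), 0 < e ->
    exists2 g, Z g & forall y, y \in l -> `|g y - f y| < e) ->
  exists2 phi : seq (nat -> set X) -> Cp R X, (forall L, Z (phi L)) &
    forall beta : nat -> nat -> set X,
      (forall i k, bounded_in R (beta i k)) ->
    forall h : Cp R X, cluster ((fun n => phi (mkseq beta n.+1)) @ \oo) h ->
    forall i k z, beta i k z -> h z = f z.
Proof.
move=> Zf.
have /choice[approx approxP] : forall p : seq X * nat, exists g : Cp R X,
    Z g /\ forall y, y \in p.1 -> `|g y - f y| < p.2.+1%:R^-1.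
  move=> [l n] /=; have [|g Zg gf] := Zf l n.+1%:R^-1.
    by rewrite invr_gt0.
  by exists g.
have /choice[net netP] := fun p : seq (X -> R) * (nat -> set X) =>
  countable_net x0 p.1 p.2.
pose cf (fs : seq (Cp R X)) := f :: [seq (g : X -> R) | g : Cp R X <- fs].
(* The history is read newest first. Each step adds nets for all families in [L], old ones included,
   because the nets must also be fine for the functions found since. *)
pose fix run (L : seq (nat -> set X)) : seq (Cp R X) * seq (nat -> X) :=
  if L is _ :: L' then
    let r := run L' in
    let cs := [seq net (cf r.1, B) | B <- L] ++ r.2 in
    (approx ([seq c j | c <- cs, j <- iota 0 (size L')], size L') :: r.1, cs)
  else ([::], [::]).
pose phi L := head (approx ([::], 0%N)) (run (rev L)).1.
exists phi => [L|beta bbeta h hcl].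
  by rewrite /phi; case: (rev L) => [|B L'] /=; have [] := approxP ([::], 0%N);
     last by move=> *; exact: (approxP _).1.
pose L n := rev (mkseq beta n); pose u n := phi (mkseq beta n.+1).
have LS n : L n.+1 = beta n :: L n by rewrite /L mkseqS rev_rcons.
have sL n : size (L n) = n by rewrite /L size_rev size_mkseq.
have fsS n : (run (L n.+1)).1 = u n :: (run (L n)).1.
  by rewrite /u /phi -/(L n.+1) LS.
have csE n : (run (L n.+1)).2 =
    [seq net (cf (run (L n)).1, B) | B <- L n.+1] ++ (run (L n)).2.
  by rewrite LS.
have fsu n i : (i < n)%N -> u i \in (run (L n)).1.
  elim: n => // n IH; rewrite ltnS leq_eqVlt fsS inE => /predU1P[->|/IH ->].
    by rewrite eqxx.
  by rewrite orbT.
have csS n c : c \in (run (L n)).2 -> c \in (run (L n.+1)).2.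
  by move=> cn; rewrite csE mem_cat cn orbT.
have csm m n c : (m <= n)%N -> c \in (run (L m)).2 -> c \in (run (L n)).2.
  by move=> /subnK <- cm; elim: (n - m)%N => // k IH; exact: csS.
have netcs n i : (i <= n)%N ->
    net (cf (run (L n)).1, beta i) \in (run (L n.+1)).2.
  move=> le_in; rewrite csE mem_cat; apply/orP; left.
  apply: (map_f (fun B => net (cf (run (L n)).1, B))).
  by rewrite /L mem_rev; apply/mapP; exists i => //; rewrite mem_iota.
have ucs m c j : c \in (run (L m)).2 -> h (c j) = f (c j).
  move=> cm; apply: (cluster_eq_lim (u := u) hcl) => e e0.
  have [p _ /= pe] := near_infty_natSinv_lt (PosNum e0).
  (* From this stage on the precision beats [e], the net [c] is listed, and its [j]-th point is
     among those sampled. *)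
  exists (maxn p (maxn m j.+1)) => n; rewrite !geq_max => /and3P[pn mn jn].
  apply: lt_trans (pe _ pn).
  pose l := [seq c j | c <- (run (L n.+1)).2, j <- iota 0 n].
  have -> : u n = approx (l, n).
    by rewrite /l /u /phi -/(L n.+1) LS /= sL.
  have [_ -> //] := approxP (l, n).
  apply/allpairsP; exists (c, j); rewrite /= mem_iota.
  by split=> //; apply: csm cm; apply: leqW.
move=> i k z Bz; apply: eqr_dist_le => e e0.
have e20 : 0 < e / 2 by rewrite divr_gt0.
have [N NP] := fiber_uniform_on_bounded
  (fun n => @cts_fun _ _ (u n)) (@cts_fun _ _ h) (bbeta i k) e20
  (fun y => @cluster_fiber _ _ u h y z hcl).
(* At stage [n] all [u i0] with [i0 < N] are known and the family [beta i] has been revealed. *)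
pose n := maxn N i.
pose d := Num.min (e / 2) N.+1%:R^-1.
have d0 : 0 < d by rewrite lt_min e20 invr_gt0 ltr0n.
have [j Bj jP] := netP (cf (run (L n)).1, beta i) k z d Bz d0.
have hf := ucs n.+1 _ j (netcs n i (leq_maxr _ _)).
set w := net _ j in Bj jP hf.
have fw : `|f w - f z| < d by apply: jP; rewrite mem_head.
have /(NP w Bj) hw : forall i0, (i0 < N)%N -> `|u i0 w - u i0 z| < N.+1%:R^-1.
  move=> i0 iN; have : `|u i0 w - u i0 z| < d.
    apply: (jP (u i0 : X -> R)); rewrite inE; apply/orP; right.
    by apply: map_f; apply: fsu; apply: leq_trans iN _; exact: leq_maxl.
  by rewrite lt_min => /andP[].
rewrite (le_trans (ler_distD (h w) _ _))// [e]splitr lerD//.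
  by rewrite distrC ltW.
by move: fw; rewrite hf lt_min => /andP[/ltW].
Qed.

(** * Passing from bounded sets to closures *)

Lemma bounded_in_set1 (R : realType) (X : topologicalType) (x : X) :
  bounded_in R [set x].
Proof.
move=> f _; exists `|f x|; split; first exact: num_real.
by move=> M ltM y /= ->; exact: ltW.
Qed.

(** Index [0] is reserved for one point, at which the cluster points of a run are thereby forced to
    agree with [f]. *)
Definition adjoin (X : Type) (x : X) (B : nat -> set X) (k : nat) : set X :=
  if k is k'.+1 then B k' else [set x].

Lemma adjoin_bounded (R : realType) (X : topologicalType) (x : X)
    (B : nat -> set X) :
  (forall k, bounded_in R (B k)) -> forall k, bounded_in R (adjoin x B k).
Proof. by move=> bB [|k] //=; exact: bounded_in_set1. Qed.

Lemma eq_on_closure (R : realType) (X : topologicalType) (D : set X)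
    (h g : X -> R) : continuous h -> continuous g ->
  (forall y, D y -> h y = g y) -> forall y, closure D y -> h y = g y.
Proof.
move=> ch cg hg y Dy; apply: eqr_dist_le => e e0.
have cd : continuous (fun y => h y - g y).
  by move=> t; apply: cvgB; [exact: ch | exact: cg].
have /cvgrPdist_lt/(_ e e0)/Dy [w [Dw]] := cd y.
by rewrite /= (hg _ Dw) subrr subr0 => /ltW.
Qed.

(** The comparison function depends on the point [z]: a run with [z] adjoined yields a continuous
    [g] equal to [f] at [z] and on every [B k], so [h] and [g] agree on the union and hence at
    [z]. *)
Lemma cluster_eq_on_closure (R : realType) (X : topologicalType)
    (Z : set (Cp R X)) (f : X -> R) (h : Cp R X) (B : nat -> set X) :
  relatively_countably_compact Z ->
  (forall (l : seq X) (e : R), 0 < e ->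
    exists2 g, Z g & forall y, y \in l -> `|g y - f y| < e) ->
  (forall k, bounded_in R (B k)) ->
  (forall k y, B k y -> h y = f y) ->
  forall y, closure (\bigcup_k B k) y -> h y = f y.
Proof.
move=> Zrcc Zf bB hf z Bz.
have [phi Zphi phiP] := tracking_functions z Zf.
have [g /phiP gP] := Zrcc _ (fun n => Zphi (mkseq (fun=> adjoin z B) n.+1)).
have {}gP := gP (fun _ => adjoin_bounded z bB) 0%N.
rewrite -(gP 0%N z erefl).
apply: (eq_on_closure (D := \bigcup_k B k)) Bz => [||y [k _ Bky]];
  [exact: cts_fun | exact: cts_fun |].
by rewrite (hf k y Bky) (gP k.+1 y Bky).
Qed.

(** * A winning strategy for beta from a discontinuous limit *)

Lemma pointwise_closure_continuous (R : realType) (X : topologicalType)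
    (Z : set (Cp R X)) (f : X -> R) :
  wb_qf_space R X -> relatively_countably_compact Z ->
  (forall (l : seq X) (e : R), 0 < e ->
    exists2 g, Z g & forall y, y \in l -> `|g y - f y| < e) ->
  continuous f.
Proof.
move=> Xwb Zrcc Zf; apply: contrapT => /Xwb[A [x [_ _ fxA]]]; apply.
have [e e0 Ae] : exists2 e : R, 0 < e & forall a, A a -> e <= `|f a - f x|.
  apply: contrapT => noe; apply: fxA => U /nbhs_ballP[e /= e0 eU].
  apply: contrapT => AU; apply: noe; exists e => // a Aa; rewrite leNgt.
  apply/negP => ae; apply: AU; exists (f a); split; first by exists a.
  by apply: eU; rewrite /ball /= distrC.
have [phi Zphi phiP] := tracking_functions x Zf.
(* A strategy must also answer illegal moves of alpha; for these a singleton serves as a dummy. *)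
have /choice[Bsel BselP] : forall S : set X, exists B : nat -> set X,
    (forall k, bounded_in R (B k)) /\
    ((exists2 L, Pb R L & S `<=` L) -> S `<=` closure (\bigcup_k B k)).
  move=> S; have [[L [D [[B bB DE] _ LD]] SL]|noL] :=
    pselect (exists2 L, Pb R L & S `<=` L); last first.
    by exists (fun=> [set x]); split=> // _; exact: bounded_in_set1.
  by exists B; split=> // _; rewrite -DE; exact: subset_trans LD.
pose b (p : set X * set X) := adjoin x (Bsel p.2).
(* Truncating the history makes the [i]-th function the same at every stage after step [i]. *)
pose psi (h : seq (set X * set X)) i : Cp R X := phi (take i.+1 (map b h)).
exists (fun h => [set y | forall i, i \in iota 0 (size h) ->
  `|psi h i y - psi h i x| < (size h).+1%:R^-1]).
split=> [h|V S Vs Sleg [T [TV _]]].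
  apply: (near_seq (F := nbhs x)
    (P := fun i y => `|psi h i y - psi h i x| < (size h).+1%:R^-1)) => i _.
  have /cvgrPdist_lt/(_ (size h).+1%:R^-1) := @cts_fun _ _ (psi h i) x.
  by rewrite invr_gt0 ltr0n => /(_ isT); apply: filterS => y; rewrite distrC.
apply; pose beta n := adjoin x (Bsel (S n)).
pose u n := phi (mkseq beta n.+1).
have [h hcl] := Zrcc u (fun n => Zphi _).
have bbeta n k : bounded_in R (beta n k).
  by apply: adjoin_bounded; exact: (BselP _).1.
have hP := phiP beta bbeta h hcl.
have hx : h x = f x by exact: (hP 0%N 0%N).
have hT y : T y -> h y = f x.
  move=> /TV Vy; rewrite -hx.
  apply: (cluster_fiber hcl) => i.
  apply: eqr_dist_le => d d0.
  have [p _ /= pd] := near_infty_natSinv_lt (PosNum d0).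
  (* At this stage [u i] already constrains beta's move, with tolerance below [d]. *)
  have := Vy (maxn p i.+1) I; rewrite Vs /= size_mkseq.
  move=> /(_ i); rewrite mem_iota add0n leq_maxr => /(_ isT).
  have -> : psi (mkseq (fun k => (V k, S k)) (maxn p i.+1)) i = u i.
    rewrite /psi /u; congr phi.
    by rewrite /mkseq -map_comp -map_take take_iota (minn_idPl _)// leq_maxr.
  by move=> /lt_trans/(_ (pd _ (leq_maxl _ _)))/ltW.
have hS y : (\bigcup_n S n) y -> e <= `|h y - f x|.
  move=> [n _ Sy]; have [SA SL] := Sleg n.
  have [bB Scl] := BselP (S n).
  rewrite (cluster_eq_on_closure Zrcc Zf bB)//.
  - by apply: Ae; exact: SA.
  - by move=> k w Bw; exact: (hP n k.+1).
  - exact: Scl.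
exists (fun y => Num.min 1 (`|h y - f x| / e)); split.
- move=> y; apply: (@continuous_min _ _ (fun=> 1) (fun w => `|h w - f x| / e)).
    exact: cvg_cst.
  apply: cvgMr_tmp; apply: cvg_norm.
  by apply: cvgB; [exact: cts_fun | exact: cvg_cst].
- move=> _ [y _ <-] /=; rewrite in_itv /= le_min ler01 ge_min lexx andbT.
  by rewrite divr_ge0// ltW.
- by move=> _ [y Ty <-] /=; rewrite hT// subrr normr0 mul0r min_r.
- move=> _ [y Sy <-] /=; rewrite min_l// ler_pdivlMr// mul1r; exact: hS.
Qed.

(** * Compactness of the closure by ultrafilters *)

Lemma rcc_pointwise_bounded (R : realType) (X : topologicalType)
    (Z : set (Cp R X)) (y : X) : relatively_countably_compact Z ->
  exists M : R, forall g, Z g -> `|g y| <= M.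
Proof.
move=> Zrcc; apply: contrapT => noM.
have /choice[u uP] : forall n : nat, exists g : Cp R X, Z g /\ n%:R < `|g y|.
  move=> n; apply: contrapT => nog; apply: noM; exists n%:R => g Zg.
  by rewrite leNgt; apply/negP => ng; apply: nog; exists g.
have [h hcl] := Zrcc u (fun n => (uP n).1).
have h0 : 0 <= `|h y| + 1 by rewrite addr_ge0.
have [m Nm /(_ y (mem_head _ _)) hm] :=
  Cp_cluster [:: y] (Num.bound (`|h y| + 1)) hcl ltr01.
have := (uP m).2; apply/negP; rewrite -leNgt.
rewrite (le_trans (_ : _ <= `|h y| + 1))//.
  by rewrite -lerBlDl (le_trans (lerB_dist _ _))// ltW.
by rewrite (le_trans (ltW (archi_boundP h0)))// ler_nat.
Qed.

Theorem theorem9 (R : realType) (X : topologicalType)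
  (X_hausdorff : hausdorff_space X)
  (X_completely_regular : completely_regular_space X) :
  wb_qf_space R X -> mu_sharp_cc_complete R X.
Proof.
move=> Xwb Z Zrcc; rewrite compact_ultra => F FU FZ.
have FF : ProperFilter F by exact: ultra_proper.
have near_Z (V : set (Cp R X)) g : closure Z g -> nbhs g V ->
  exists2 k, Z k & V k by move=> Zg /Zg[k [Zk Vk]]; exists k.
(* Along the ultrafilter each evaluation stays in a compact segment, hence converges; [f] collects
   the limits. The segment has slack [1] since [F] lives on [closure Z] while [M] bounds [Z]. *)
have /choice[f Ff] : forall y, exists r : R,
    (fun g : Cp R X => g y) @ F --> r.
  move=> y; have [M ZM] := rcc_pointwise_bounded y Zrcc.
  have FM : ((fun g : Cp R X => g y) @ F) [set` `[- (M + 1), M + 1]].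
    apply: (@filterS _ F _ (closure Z) _ _ FZ) => g Zg /=.
    have /cvgrPdist_lt/(_ 1 ltr01)/Zg[k [/ZM kM gk]] :=
      @Cp_eval_continuous R X y g.
    rewrite in_itv /= -ler_norml -lerBlDl.
    rewrite (le_trans _ (ltW gk))// (le_trans _ (lerB_dist _ _))//.
    by rewrite lerB.
  have [r [_ Fr]] := @segment_compact R (- (M + 1)) (M + 1) _ _ FM.
  exists r => U Ur.
  have [//|FU'] := in_ultra_setVsetC ((fun g : Cp R X => g y) @^-1` U) FU.
  by have [t [/[apply]]] := Fr (~` U) U FU' Ur.
(* Half of [e] is spent from [f] to some [g] in [closure Z], the other half from [g] to [Z]. *)
have Zf (l : seq X) (e : R) : 0 < e ->
    exists2 g, Z g & forall y, y \in l -> `|g y - f y| < e.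
  move=> e0; have e20 : 0 < e / 2 by rewrite divr_gt0.
  have Fl : F [set g : Cp R X | forall y, y \in l -> `|g y - f y| < e / 2].
    apply: (near_seq (F := F) (P := fun y g => `|g y - f y| < e / 2)) => y _.
    have /cvgrPdist_lt/(_ _ e20) := Ff y.
    by apply: filterS => g; rewrite distrC.
  have [g [Zg gf]] := filter_ex (filterI FZ Fl).
  have gl : nbhs g [set k : Cp R X | forall y, y \in l -> `|k y - g y| < e / 2].
    apply: (near_seq (F := nbhs g) (P := fun y k => `|k y - g y| < e / 2)).
    move=> y _; have /cvgrPdist_lt/(_ _ e20) := @Cp_eval_continuous R X y g.
    by apply: filterS => k; rewrite distrC.
  have [k Zk kg] := near_Z _ _ Zg gl; exists k => // y yl.
  by rewrite (le_lt_trans (ler_distD (g y) _ _))// [e]splitr ltrD// ?kg// gf.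
have cf := pointwise_closure_continuous Xwb Zrcc Zf.
pose q : Cp R X := HB.pack f (isContinuous.Build X R f cf).
have Fq : F --> q by apply: Cp_cvgP => y; exact: Ff.
exists q; split=> //.
exact: (closed_cvg (closure Z) (@closed_closure _ Z) FZ q Fq).
Qed.
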